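(* (i) Let $\gamma$ be a non-zero ordinal, written $\gamma=\omega^{\epsilon_0}+\ldots+\omega^{\epsilon_l}$ with $\epsilon_0\geqslant\ldots\geqslant\epsilon_l$; let $\gamma_0=0$ and $\gamma_{i+1}=\gamma_i+\omega^{\epsilon_i}$ for $i\leqslant l$. Suppose $P$ is a tree with $\mathrm{rank}(P)=\gamma$, $k<\omega$, $f:P\to k+1$, and $Q\subset P$, $F:l+1\to k+1$ satisfy $\mathrm{rank}(Q)=\mathrm{rank}(P)$ and for each $i\leqslant l$: $Q^{\gamma_i}\setminus Q^{\gamma_{i+1}}=Q\cap(P^{\gamma_i}\setminus P^{\gamma_{i+1}})$, $\varsigma_{Q^{\gamma_i}\setminus Q^{\gamma_{i+1}}}=\varsigma_{P^{\gamma_i}\setminus P^{\gamma_{i+1}}}|_{\Lambda_2(Q^{\gamma_i}\setminus Q^{\gamma_{i+1}})}$, and $f|_{Q^{\gamma_i}\setminus Q^{\gamma_{i+1}}}\equiv F(i)$. Fix $j\leqslant k$, let $A=\{i\leqslant l:F(i)=j\}$ and $\alpha=\omega^{\epsilon_{a(0)}}+\ldots+\omega^{\epsilon_{a(p)}}$ where $A=\{a(0),\ldots,a(p)\}$ with $a(0)<\ldots<a(p)$, and $\alpha=0$ if $A=\varnothing$. Then there exists a subtree $R$ of $P$ with $\mathrm{rank}(R)=\alpha$ such that $f|_R\equiv j$. (ii) For $k,l<\omega$ let $F:l+1\to k+1$ be a function, fix $\epsilon_0\geqslant\ldots\geqslant\epsilon_l$, let $\gamma_i$ be as in (i), fix a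 tree $P$ with $\mathrm{rank}(P)=\omega^{\epsilon_0}+\ldots+\omega^{\epsilon_l}$, and define $f:P\to k+1$ by $f|_{P^{\gamma_i}\setminus P^{\gamma_{i+1}}}\equiv F(i)$ for $i\leqslant l$. If $j\leqslant k$, $A$ and $\alpha$ are as in (i), and $Q$ is any subtree of $P$ with $f|_Q\equiv j$, then $\mathrm{rank}(Q)\leqslant\alpha$.
   Context: A tree is a partially ordered set $(P,\leqslant)$ such that for every $t\in P$ the set $\{s\in P: s\leqslant t\}$ is well-ordered; subsets carry the induced order. $\mathrm{Leaves}(P)$ is the set of maximal elements; $P'=P\setminus\mathrm{Leaves}(P)$; $P^0=P$, $P^{\xi+1}=(P^\xi)'$, $P^\xi=\bigcap_{\zeta<\xi}P^\zeta$ for limit $\xi$. For well-founded $P$, $\mathrm{rank}(P)=\min\{\xi:P^\xi=\varnothing\}$ and $\tau_{P,\beta}(t)=\max\{\xi:t\in P^{\beta\cdot\xi}\}$. $\Lambda_2(P)=\{(s,t):s<t\}$. Separation: for a tree $T$ of additively indecomposable rank $\delta=\omega^{\omega^{\eta_0}}\cdot\ldots\cdot\omega^{\omega^{\eta_m}}$ ($\eta_0\geqslant\ldots\geqslant\eta_m$), $\varsigma_T(s,t)=\min\{i\leqslant m:\tau_{T,\alpha_i}(s)=\tau_{T,\alpha_i}(t)\}$ where $\alpha_i=\omega^{\omega^{\eta_0}}\cdot\ldots\cdot\omega^{\omega^{\eta_i}}$; for rank $1$ it is the empty function. The sets $P^{\gamma_i}\setminus P^{\gamma_{i+1}}$ have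 rank $\omega^{\epsilon_i}$. *)

(* Defs.v *)
From mathcomp Require Import all_boot all_order.
From mathcomp Require Import boolp classical_sets wochoice.

Set Implicit Arguments.
Unset Strict Implicit.
Unset Printing Implicit Defensive.

Import Order.TTheory.
Local Open Scope order_scope.
Local Open Scope classical_set_scope.

(* Ordinals are generated by zero, successor and suprema of nonempty          *)
(* [Type]-indexed families; [i0] witnesses nonemptiness, so that the limit    *)
(* clauses below ([omul], [oexp], [deriv], ...) are taken over a nonempty     *)
(* index and stay correct for non-increasing or attained suprema.  Different  *)
(* terms may denote the same ordinal: [ole] is a well-founded total preorder, *)
(* and equality of ordinals is [oeq].  Everything defined below respects      *)
(* [oeq]; see the lemmas at the end.                                          *)
Inductive ord : Type :=
| ozero
| osucc of ord
| osup (I : Type) (i0 : I) (f : I -> ord).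

Fixpoint ole (x : ord) : ord -> Prop :=
  match x with
  | ozero => fun=> True
  | osucc x' =>
      fix lt_x' (y : ord) : Prop :=
        match y with
        | ozero => False
        | osucc y' => ole x' y'
        | osup _ _ g => exists i, lt_x' (g i)
        end
  | osup _ _ f => fun y => forall i, ole (f i) y
  end.

Definition olt (x y : ord) : Prop := ole (osucc x) y.

Definition oeq (x y : ord) : Prop := ole x y /\ ole y x.

Fixpoint oadd (x y : ord) : ord :=
  match y with
  | ozero => x
  | osucc y' => osucc (oadd x y')
  | osup _ i0 g => osup i0 (fun i => oadd x (g i))
  end.

Fixpoint omul (x y : ord) : ord :=
  match y with
  | ozero => ozero
  | osucc y' => oadd (omul x y') x
  | osup _ i0 g => osup i0 (fun i => omul x (g i))
  end.

Definition oone : ord := osucc ozero.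

(* Used only with base omega: for base zero the supremum clause would not be  *)
(* the usual convention.                                                      *)
Fixpoint oexp (x y : ord) : ord :=
  match y with
  | ozero => oone
  | osucc y' => omul (oexp x y') x
  | osup _ i0 g => osup i0 (fun i => oexp x (g i))
  end.

Definition oomega : ord := osup 0%N (fun n => iter n osucc ozero).

Definition least_ord (S : set ord) (x : ord) : Prop :=
  S x /\ forall y, S y -> ole x y.

Definition greatest_ord (S : set ord) (x : ord) : Prop :=
  S x /\ forall y, S y -> ole y x.

Section Trees.
Context {d : Order.disp_t} {T : porderType d}.
Implicit Types (A : set T) (s t : T).

Definition is_tree : Prop :=
  forall t, wo_chain (@Order.le d T) [pred s | s <= t].

Definition leaves A : set T :=
  [set t | A t /\ forall s, A s -> t <= s -> s = t].

(* Since the sequence is decreasing, the intersection along any family with   *)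
(* supremum a limit xi is the intersection over all zeta < xi.                *)
Fixpoint deriv A (x : ord) : set T :=
  match x with
  | ozero => A
  | osucc x' => deriv A x' `\` leaves (deriv A x')
  | osup _ _ f => \bigcap_i deriv A (f i)
  end.

(* The relation "rank(A) = x"; it holds for no x when A is not well-founded.  *)
Definition has_rank A (x : ord) : Prop :=
  least_ord [set z | deriv A z = set0] x.

(* The relation "tau_{A,b}(t) = x". *)
Definition has_tau A (b : ord) t (x : ord) : Prop :=
  greatest_ord [set z | deriv A (omul b z) t] x.

Definition lambda2 A s t : Prop := [/\ A s, A t & s < t].

(* omega^(omega^e_0) * ... * omega^(omega^e_{n-1}) for e = [:: e_0; e_1; ...] *)
Definition omega_prod (e : seq ord) (n : nat) : ord :=
  \big[omul/oone]_(x <- take n e) oexp oomega (oexp oomega x).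

(* The graph of the separation of A: "varsigma_A(s, t) = i".  The empty       *)
(* sequence e is the rank 1 case, in which no i qualifies.                    *)
Definition has_sep A s t (i : nat) : Prop :=
  exists e : seq ord,
    [/\ forall p q, (p <= q < size e)%N ->
          ole (nth ozero e q) (nth ozero e p),
        has_rank A (omega_prod e (size e)) &
        let same_tau p := (p < size e)%N /\
          exists x, has_tau A (omega_prod e p.+1) s x /\
                    has_tau A (omega_prod e p.+1) t x in
        same_tau i /\ forall p, same_tau p -> (i <= p)%N].

(* gamma_i = omega^(eps_0) + ... + omega^(eps_{i-1}) *)
Definition cnf_sum (l : nat) (eps : 'I_l.+1 -> ord) (i : nat) : ord :=
  \big[oadd/ozero]_(p < l.+1 | (p < i)%N) oexp oomega (eps p).

(* A^(gamma_i) \ A^(gamma_{i+1}) *)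
Definition layer (l : nat) (eps : 'I_l.+1 -> ord) A (i : nat) : set T :=
  deriv A (cnf_sum eps i) `\` deriv A (cnf_sum eps i.+1).

End Trees.

Arguments is_tree {d} T.

Lemma ole_sup (x : ord) (I : Type) (i0 : I) (f : I -> ord) (i : I) :
  ole x (f i) -> ole x (osup i0 f).
Proof.
elim: x => [|x _|J j0 g IH] //=; first by exists i.
by move=> gf j; exact: IH.
Qed.

Lemma ole_succ (x y : ord) : ole x y -> ole x (osucc y).
Proof.
elim: x y => [|x IH|I i0 f IH] //= y; last by move=> fy i; exact: IH.
elim: y => [|y _|J j0 g IHy] //=; first exact: IH.
by case=> j /IHy; exact: ole_sup.
Qed.

Lemma olt_ole (x y : ord) : olt x y -> ole x y.
Proof.
elim: y => [|y _|J j0 g IH] //=; first exact: ole_succ.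
by case=> j /IH; exact: ole_sup.
Qed.

Lemma ole_refl (x : ord) : ole x x.
Proof.
elim: x => [|x IH|I i0 f IH] //= i.
exact: (@ole_sup _ _ i0 _ i).
Qed.

Lemma ole_trans (y x z : ord) : ole x y -> ole y z -> ole x z.
Proof.
elim: x y z => [|x IHx|I i0 f IH] // y z; last first.
  by move=> fy yz i; exact: IH (fy i) yz.
elim: y => [|y _|J j0 g IHy] //=; last by case=> j /IHy gz /(_ j)/gz.
move=> xy; elim: z => [|z _|K k0 h IHz] //=; first exact: IHx.
by case=> k /IHz; exists k.
Qed.

Lemma ole_total (x y : ord) : ole x y \/ olt y x.
Proof.
elim: x y => [|x IHx|I i0 f IH] y; first by left.
- elim: y => [|y _|J j0 g IHy]; [by right | exact: IHx |].
  have [[j xg]|nxg] := pselect (exists j, olt x (g j)); first by left; exists j.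
  by right=> j; case: (IHy j) => // xg; case: nxg; exists j.
- have [[i yf]|nyf] := pselect (exists i, olt y (f i)); first by right; exists i.
  by left=> i; case: (IH i y) => // yf; case: nyf; exists i.
Qed.

Lemma olt_wf : well_founded olt.
Proof.
move=> x; suff: forall y, ole y x -> Acc olt y by apply; exact: ole_refl.
elim: x => [|x IH|I i0 f IH] y yx; constructor=> z zy.
- by have := ole_trans zy yx.
- by apply: IH; have := ole_trans zy yx.
- have [i zf] := ole_trans zy yx.
  by apply: (IH i); exact: olt_ole.
Qed.

Lemma oadd_mono (x x' y y' : ord) :
  ole x x' -> ole y y' -> ole (oadd x y) (oadd x' y').
Proof.
move=> xx' yy'; apply: (@ole_trans (oadd x' y)).
  by elim: y {yy'} => [|y IH|I i0 f IH] //= i; exact: (@ole_sup _ _ i0 _ i).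
elim: y y' yy' => [|y IH|I i0 f IH] y' //=; last by move=> fy i; exact: IH.
- move=> _; elim: y' => [|y' IH|J j0 g IH] //=; first exact: ole_refl.
    exact: ole_succ.
  exact: (@ole_sup _ _ j0 _ j0).
- elim: y' => [|y' _|J j0 g IHy'] //=; first exact: IH.
  by case=> j /IHy'; exists j.
Qed.

Lemma omul_mono (x x' y y' : ord) :
  ole x x' -> ole y y' -> ole (omul x y) (omul x' y').
Proof.
move=> xx' yy'; apply: (@ole_trans (omul x' y)).
  elim: y {yy'} => [|y IH|I i0 f IH] //=; first exact: oadd_mono.
  by move=> i; exact: (@ole_sup _ _ i0 _ i).
elim: y y' yy' => [|y IH|I i0 f IH] y' //=; last by move=> fy i; exact: IH.
elim: y' => [|y' _|J j0 g IHy'] //=.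
  by move=> yy'; apply: oadd_mono (ole_refl _); exact: IH.
by case=> j /IHy'; exact: ole_sup.
Qed.

Lemma oexp_mono (x y y' : ord) :
  ole oone x -> ole y y' -> ole (oexp x y) (oexp x y').
Proof.
move=> x1; have le_mul a : ole a (omul a x).
  apply: (@ole_trans (omul a oone)); last exact: omul_mono (ole_refl a) x1.
  elim: a => [|a IH|I i0 f IH] //= i.
  apply: (@ole_sup _ _ i0 _ i); exact: IH.
have one_le z : ole oone (oexp x z).
  elim: z => [|z IH|J j0 g IH]; first exact: ole_refl.
    exact: ole_trans IH (le_mul _).
  exact: (@ole_sup _ _ j0 _ j0).
elim: y y' => [|y IH|I i0 f IH] y'; last by move=> fy i; exact: IH.
- by move=> _; exact: one_le.
- elim: y' => [|y' _|J j0 g IHy'] //=.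
    by move=> yy'; apply: omul_mono (ole_refl _); exact: IH.
  by case=> j /IHy'; exact: ole_sup.
Qed.

Lemma deriv_anti (d : Order.disp_t) (T : porderType d) (A : set T) (x y : ord) :
  ole x y -> deriv A y `<=` deriv A x.
Proof.
elim: x y => [|x IH|I i0 f IH] y /=.
- move=> _; elim: y => [|y IH|J j0 g IH] //= t; first by case=> /IH.
  by move=> /(_ j0 Logic.I)/IH.
- elim: y => [|y _|J j0 g IHy] //=; last by case=> j /IHy sub t /(_ j Logic.I)/sub.
  move=> /IH sub t [At nleaf]; split; first exact: sub.
  by case=> _ max; apply: nleaf; split=> // s /sub; exact: max.
- by move=> fy t At i _; exact: IH At.
Qed.

(* Main.v *)
(* Both parts compare the derivatives of a tree A with those of a subset R    *)
(* of a union of its layers L_i = A^(gamma_i) \ A^(gamma_{i+1}), i in C.      *)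
(* With alpha_i the sum of the omega^(eps_p) over p in C, p < i, induction on *)
(* i gives R^(alpha_i) <= A^(gamma_i), because a layer outside C costs no     *)
(* derivative of R; hence rank R <= alpha.  If R is the whole union, then     *)
(* R /\ A^(gamma_i) <= R^(alpha_i): above any point of A^(gamma_i) of         *)
(* relative rank > x there is a point of relative rank exactly x, which for   *)
(* x < omega^(eps_i) belongs to L_i, so the layers missing from R are         *)
(* invisible to its derivatives.  These exact-rank points also show that R^y  *)
(* is nonempty for every y < alpha.                                           *)

Require Import Defs.
From HB Require Import structures.
From mathcomp Require Import all_boot all_order.
From mathcomp Require Import boolp classical_sets.

Set Implicit Arguments.
Unset Strict Implicit.
Unset Printing Implicit Defensive.

Import Order.TTheory.
Local Open Scope order_scope.
Local Open Scope classical_set_scope.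

(** Let [C] be the indices of colour [j]. In (i), [R] is the union of the layers of [Q] with index
    in [C]; in (ii), every layer of [P] that meets [Q] has its index in [C]. The upper bound
    [deriv_psum_sub] serves both parts. The lower bound, for (i), rests on [exists_exact_rank], used
    through [setI_deriv_sub] and [deriv_psum_neq0]. *)

Lemma olt_irrefl x : ~ olt x x.
Proof. by elim/(well_founded_ind olt_wf): x => x IH xx; exact: (IH _ xx xx). Qed.

Lemma oadd0o : left_id ozero oadd.
Proof.
elim=> [|x IH|I i0 g IH] //=; first by rewrite IH.
by congr osup; apply/funext.
Qed.

Lemma oaddA : associative oadd.
Proof.
move=> x y; elim=> [|z IH|I i0 g IH] //=; first by rewrite IH.
by congr osup; apply/funext.
Qed.

HB.instance Definition _ :=
  Monoid.isLaw.Build ord ozero oadd oaddA oadd0o (fun=> erefl).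

Lemma oadd_ler x y : ole x (oadd x y).
Proof.
elim: y => [|y IH|I i0 g IH] /=; first exact: ole_refl.
  exact: ole_succ.
exact: (@ole_sup _ _ i0 _ i0).
Qed.

(** A weak left subtraction of [a] from [y]; an upper bound on [y] suffices because derivatives
    decrease. *)
Lemma olt_oadd y a b : olt y (oadd a b) ->
  olt y a \/ exists2 x, olt x b & ole y (oadd a x).
Proof.
elim: b => [|b _|I i0 g IH] /=; first by left.
  by move=> yab; right; exists b => //; exact: ole_refl.
case=> i /IH[|[x xg yx]]; first by left.
by right; exists x => //; exists i.
Qed.

Lemma least_ord_ex (S : set ord) x : S x -> exists y, least_ord S y.
Proof.
elim/(well_founded_ind olt_wf): x => x IH Sx.
have [[y [Sy yx]]|nS] := pselect (exists y, S y /\ olt y x).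
  exact: IH yx Sy.
exists x; split=> // y Sy.
by have [//|yx] := ole_total x y; case: nS; exists y.
Qed.

(** * Partial sums restricted to a set of indices *)

Section PartialSums.
Variables (n : nat) (b : 'I_n -> ord).
Implicit Types (C : pred 'I_n) (i : nat).

Definition psum C i : ord := \big[oadd/ozero]_(p < n | C p && (p < i)%N) b p.

Lemma psum0 C : psum C 0 = ozero.
Proof. by rewrite /psum big_pred0 // => p; rewrite ltn0 andbF. Qed.

Lemma psum_full C : psum C n = \big[oadd/ozero]_(p < n | C p) b p.
Proof. by apply: eq_bigl => p; rewrite ltn_ord andbT. Qed.

Lemma psumS C (i : 'I_n) :
  psum C i.+1 = if C i then oadd (psum C i) (b i) else psum C i.
Proof.
(* [g] extends [b] by zero and absorbs the filter [C], so that the last summand can be split off. *)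
pose g m := if insub m is Some p then if C p then b p else ozero else ozero.
have psumE m : (m <= n)%N -> psum C m = \big[oadd/ozero]_(0 <= p < m) g p.
  move=> mn; rewrite (@big_nat_widen _ _ _ 0 m n) // big_mkord /psum.
  rewrite (eq_bigl (fun p : 'I_n => (p < m)%N && C p)); last first.
    by move=> p; rewrite andbC.
  rewrite big_mkcondr; apply: eq_bigr => p _.
  by rewrite /g valK.
rewrite !psumE ?(ltnW (ltn_ord i)) // big_nat_recr //= [in g i]/g valK.
by case: (C i).
Qed.

Lemma psum_mono C i i' : (i <= i' <= n)%N -> ole (psum C i) (psum C i').
Proof.
elim: i' => [|m IH]; first by rewrite leqn0 => /andP[/eqP-> _]; exact: ole_refl.
case/andP; rewrite leq_eqVlt => /predU1P[-> _|im mn]; first exact: ole_refl.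
have /IH im' : (i <= m <= n)%N by rewrite -ltnS im ltnW.
apply: ole_trans im' _; rewrite (psumS C (Ordinal mn)).
by case: ifP => _; [exact: oadd_ler | exact: ole_refl].
Qed.

End PartialSums.

(** * Derivatives of subsets and points of exact rank *)

Section Deriv.
Context {d : Order.disp_t} {T : porderType d}.
Implicit Types (A B R U : set T).

Lemma deriv_oadd A x y : deriv A (oadd x y) = deriv (deriv A x) y.
Proof.
elim: y => [|y IH|I i0 g IH] //=; first by rewrite IH.
by apply: eq_bigcapr => i _; exact: IH.
Qed.

Lemma deriv_sub A x : deriv A x `<=` A.
Proof. exact: (@deriv_anti _ _ A ozero). Qed.

Lemma derivS A B x : A `<=` B -> deriv A x `<=` deriv B x.
Proof.
move=> AB; elim: x => [|x IH|I i0 g IH] //= t; last first.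
  by move=> At i _; apply: IH (At i _).
case=> At nleaf; split; first exact: IH.
by case=> _ tmax; apply: nleaf; split=> // s /IH; exact: tmax.
Qed.

(** Otherwise no point of [deriv B x] above [s] is maximal there, so these points survive every
    derivative, against [deriv B y = set0]. *)
Lemma exists_exact_rank B y x s : deriv B y = set0 -> deriv B x s ->
  exists s', [/\ s <= s', deriv B x s' & ~ deriv B (osucc x) s'].
Proof.
move=> By0 Bxs; apply: contrapT => nex.
pose S := [set s' | s <= s' /\ deriv B x s'].
have S_succ : S `<=` deriv B (osucc x).
  move=> s' [ss' Bs']; apply: contrapT => nBs'.
  by apply: nex; exists s'.
have S_all z : S `<=` deriv B z.
  elim: z => [|z IH|I i0 g IH] /= t St.
  - by case: St => _ /deriv_sub.
  - split; first exact: IH.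
    case=> _ tmax; have [Bt] := S_succ _ St; apply; split=> // r Br tr.
    by apply: tmax => //; apply: IH; split=> //; case: St => st _; exact: le_trans tr.
  - by move=> i _; exact: IH.
have : deriv B y s by apply: S_all; split.
by rewrite By0.
Qed.

Section Cofinal.
Variables (B U : set T) (b y : ord).
Hypotheses (By0 : deriv B y = set0) (BU : B `\` deriv B b `<=` U).

(** At a successor, if [s] lies above [t] in [deriv B x], a point [s'] above [s] of exact rank [x]
    is outside [deriv B b], hence in [U], and by induction in [deriv U x]; so [t] is not maximal
    there. *)
Lemma setI_deriv_sub x : ole x b -> U `&` deriv B x `<=` deriv U x.
Proof.
elim: x => [|x IH|I i0 g IH] xb t [Ut] /=; [by []| |]; last first.
  by move=> Bt i _; apply: IH (xb i) _ _; split=> //; exact: Bt.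
have {}IH := IH (olt_ole xb).
case=> Bt nleaf; split; first exact: IH.
case=> _ tmax; apply: nleaf; split=> // s Bs ts.
have [s' [ss' Bs' nBs']] := exists_exact_rank By0 Bs.
have Us' : U s'.
  by apply: BU; split; [exact: deriv_sub Bs' | move=> /(deriv_anti xb)].
have s't : s' = t by apply: tmax; [exact: IH | exact: le_trans ss'].
by apply: le_anti; rewrite ts -s't ss'.
Qed.

Lemma deriv_neq0 x : olt x b -> deriv B x !=set0 -> deriv U x !=set0.
Proof.
move=> xb [s Bs]; have [s' [_ Bs' nBs']] := exists_exact_rank By0 Bs.
exists s'; apply: setI_deriv_sub (olt_ole xb) _ _; split=> //.
by apply: BU; split; [exact: deriv_sub Bs' | move=> /(deriv_anti xb)].
Qed.

End Cofinal.

(** * Rank of a set spread over chosen layers *)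

Section Layers.
Variables (l : nat) (eps : 'I_l.+1 -> ord) (C : pred 'I_l.+1) (A R : set T).

Let b i := oexp oomega (eps i).

Lemma cnf_sum0 : cnf_sum eps 0 = ozero.
Proof. exact: (psum0 b xpredT). Qed.

Lemma cnf_sumS (i : 'I_l.+1) :
  cnf_sum eps i.+1 = oadd (cnf_sum eps i) (b i).
Proof. exact: (psumS b xpredT i). Qed.

Lemma deriv_psum_sub : R `<=` A ->
    (forall (i : 'I_l.+1) t, R t -> layer eps A i t -> C i) ->
  forall i, (i <= l.+1)%N -> deriv R (psum b C i) `<=` deriv A (cnf_sum eps i).
Proof.
move=> RA RC; elim=> [|i IH] il; first by rewrite cnf_sum0 psum0.
rewrite (psumS b C (Ordinal il)) (cnf_sumS (Ordinal il)) /=.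
have {}IH := IH (ltnW il).
case: ifPn => [_|/negP nCi] t; first by rewrite !deriv_oadd; exact: derivS.
(* A point of [R] lost between the two derivatives of [A] would lie in layer [i], forcing [C i]. *)
move=> Rt; apply: contrapT => nAt; apply: nCi; apply: (RC _ t).
  exact: deriv_sub Rt.
by split; [exact: IH | rewrite (cnf_sumS (Ordinal il))].
Qed.

Lemma deriv_sum_eq0 : R `<=` A -> deriv A (cnf_sum eps l.+1) = set0 ->
    (forall (i : 'I_l.+1) t, R t -> layer eps A i t -> C i) ->
  deriv R (\big[oadd/ozero]_(i < l.+1 | C i) b i) = set0.
Proof.
move=> RA A0 RC; rewrite -psum_full -subset0 -A0.
exact: deriv_psum_sub.
Qed.

Hypotheses (A_rank : has_rank A (cnf_sum eps l.+1)).
Hypothesis R_layer : forall i : 'I_l.+1, C i -> layer eps A i `<=` R.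

(** The hypothesis [BU] for [B] the derivative of [A] at gamma_i and [U] its trace on [R]. *)
Lemma layer_setI_sub (i : 'I_l.+1) : C i ->
  deriv A (cnf_sum eps i) `\` deriv (deriv A (cnf_sum eps i)) (b i)
    `<=` R `&` deriv A (cnf_sum eps i).
Proof.
move=> Ci t; rewrite -deriv_oadd -cnf_sumS => Lt.
by split; [exact: R_layer Ci _ Lt | case: Lt].
Qed.

Lemma deriv_deriv_eq0 i :
  deriv (deriv A (cnf_sum eps i)) (cnf_sum eps l.+1) = set0.
Proof.
case: A_rank => /= A0 _; rewrite -subset0 -A0; apply: derivS; exact: deriv_sub.
Qed.

Lemma sub_deriv_psum i : (i <= l.+1)%N ->
  R `&` deriv A (cnf_sum eps i) `<=` deriv R (psum b C i).
Proof.
elim: i => [|i IH] il; first by rewrite psum0 => t [].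
have {}IH := IH (ltnW il).
rewrite (psumS b C (Ordinal il)) (cnf_sumS (Ordinal il)) /= !deriv_oadd => t [Rt At].
case: ifPn => Ci; last by apply: IH; split=> //; exact: deriv_sub At.
rewrite deriv_oadd; apply: (derivS IH).
apply: (setI_deriv_sub (deriv_deriv_eq0 i) (layer_setI_sub Ci) (ole_refl _)).
by split=> //; split=> //; exact: deriv_sub At.
Qed.

Lemma deriv_psum_neq0 i y : (i <= l.+1)%N -> olt y (psum b C i) ->
  deriv R y !=set0.
Proof.
elim: i => [|i IH] il; first by rewrite psum0.
rewrite (psumS b C (Ordinal il)) /=; have {}IH := IH (ltnW il).
case: ifPn => // Ci /olt_oadd[//|[x xb yx]].
suff [t Ut] : deriv (R `&` deriv A (cnf_sum eps i)) x !=set0.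
  exists t; apply: deriv_anti yx _ _; rewrite deriv_oadd.
  exact: derivS (sub_deriv_psum (ltnW il)) _ Ut.
apply: (deriv_neq0 (deriv_deriv_eq0 i) (layer_setI_sub Ci) xb).
(* The derivative of [A] at gamma_i + x is nonempty, as gamma_i + x < gamma_{i+1} is below the rank
   of [A]. *)
apply/set0P/eqP; rewrite -deriv_oadd => /A_rank.2 le_gamma.
apply: (@olt_irrefl (oadd (cnf_sum eps i) x)).
apply: ole_trans le_gamma.
apply: (@ole_trans (cnf_sum eps i.+1)); last first.
  by apply: (psum_mono b xpredT); rewrite il leqnn.
by rewrite (cnf_sumS (Ordinal il)); exact: (oadd_mono (ole_refl _) xb).
Qed.

Lemma has_rank_layers : R `<=` A ->
    (forall (i : 'I_l.+1) t, R t -> layer eps A i t -> C i) ->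
  has_rank R (\big[oadd/ozero]_(i < l.+1 | C i) b i).
Proof.
move=> RA RC; split; first exact: deriv_sum_eq0 RA A_rank.1 RC.
move=> y /= Ry0; rewrite -psum_full.
have [//|/deriv_psum_neq0] := ole_total (psum b C l.+1) y.
by move=> /(_ (leqnn _)) [t]; rewrite Ry0.
Qed.

End Layers.

Lemma has_rank_oeq A x y : oeq x y -> has_rank A x -> has_rank A y.
Proof.
move=> [xy yx] [/= Ax0 xmin]; split=> [|z /xmin]; last exact: ole_trans.
by rewrite /= -subset0 -Ax0; exact: deriv_anti.
Qed.

End Deriv.

Theorem theorem4p9 :
  (* (i) *)
  (forall (l : nat) (eps : 'I_l.+1 -> ord)
     (eps_noninc : forall p q : 'I_l.+1, (p <= q)%N -> ole (eps q) (eps p))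
     (gamma : ord) (gammaE : oeq gamma (cnf_sum eps l.+1))
     (d : Order.disp_t) (P : porderType d) (P_tree : is_tree P)
     (P_rank : has_rank [set: P] gamma)
     (k : nat) (f : P -> 'I_k.+1) (Q : set P) (F : 'I_l.+1 -> 'I_k.+1)
     (Q_rank : has_rank Q gamma)
     (Q_layer : forall i : 'I_l.+1,
        layer eps Q i = Q `&` layer eps [set: P] i)
     (Q_sep : forall (i : 'I_l.+1) (s t : P),
        lambda2 (layer eps Q i) s t ->
        forall n : nat, has_sep (layer eps Q i) s t n <->
                        has_sep (layer eps [set: P] i) s t n)
     (Q_col : forall (i : 'I_l.+1) (t : P), layer eps Q i t -> f t = F i)
     (j : 'I_k.+1),
   exists R : set P,
     has_rank R (\big[oadd/ozero]_(i < l.+1 | F i == j) oexp oomega (eps i)) /\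
     forall t : P, R t -> f t = j)
  /\
  (* (ii) *)
  (forall (k l : nat) (F : 'I_l.+1 -> 'I_k.+1) (eps : 'I_l.+1 -> ord)
     (eps_noninc : forall p q : 'I_l.+1, (p <= q)%N -> ole (eps q) (eps p))
     (d : Order.disp_t) (P : porderType d) (P_tree : is_tree P)
     (P_rank : has_rank [set: P] (cnf_sum eps l.+1))
     (f : P -> 'I_k.+1)
     (f_col : forall (i : 'I_l.+1) (t : P),
        layer eps [set: P] i t -> f t = F i)
     (j : 'I_k.+1) (Q : set P) (Q_col : forall t : P, Q t -> f t = j),
   exists2 rho : ord, has_rank Q rho &
     ole rho (\big[oadd/ozero]_(i < l.+1 | F i == j) oexp oomega (eps i))).
Proof.
split.
- move=> l eps _ gamma gammaE d P _ _ k f Q F Q_rank _ _ Q_col j.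
  have {}Q_rank := has_rank_oeq gammaE Q_rank.
  pose R := \bigcup_(i in [set i | F i == j]) layer eps Q i.
  have R_col t : R t -> f t = j.
    by case=> i /= /eqP <-; exact: Q_col.
  exists R; split=> //; apply: (@has_rank_layers _ _ _ _ _ Q) => //.
  + by move=> i Fi t Lt; exists i.
  + by move=> t [i _ [/deriv_sub]].
  (* Both [j] and [F i] are the colour of [t]. *)
  + by move=> i t /R_col <- /Q_col ->.
- move=> k l F eps _ d P _ [/= P0 _] f f_col j Q Q_col.
  have Q0 : deriv Q (\big[oadd/ozero]_(i < l.+1 | F i == j)
                       oexp oomega (eps i)) = set0.
    by apply: deriv_sum_eq0 P0 _ => // i t /Q_col <- /f_col ->.
  (* Vanishing at alpha yields both the existence of the rank and its bound. *)
  have [rho rhoP] := @least_ord_ex [set z | deriv Q z = set0] _ Q0.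
  by exists rho => //; apply: rhoP.2.
Qed.
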